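(* Let $f\in\mathcal{F}(\mathbb{R}^n)$ and let $\tilde f(x)=f(-x)$. Then $$ \int_{\mathbb{R}^n} (f\star\tilde f)(x)\,dG_n(x)\leq\binom{2n}{n}\Vert f\Vert_\infty\int_{\mathbb{R}^n}(f\star\chi_{\frac34 C_n})(x)\,dG_n(x). $$
   Context: A function $f:\mathbb{R}^n\to[0,\infty)$ is log-concave if $f=e^{-u}$ with $u:\mathbb{R}^n\to(-\infty,\infty]$ convex (with $e^{-\infty}=0$). $\mathcal{F}(\mathbb{R}^n)$ is the set of Lebesgue-integrable log-concave functions on $\mathbb{R}^n$ with positive integral; $\Vert f\Vert_\infty=\sup f$. $G_n$ is the lattice point enumerator measure, $G_n(A)=\#(A\cap\mathbb{Z}^n)$. $C_n=(-1,1)^n$, $\frac34C_n=(-\frac34,\frac34)^n$, and $\chi_A$ is the characteristic function of $A$. The Asplund product is $(f\star g)(x)=\sup_{z\in\mathbb{R}^n}f(z)g(x-z)$. *)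

(* Defs.v *)
From HB Require Import structures.
From mathcomp Require Import all_boot all_order all_algebra.
From mathcomp Require Import all_classical all_reals all_analysis.

Set Implicit Arguments.
Unset Strict Implicit.
Unset Printing Implicit Defensive.

Import Order.TTheory GRing.Theory Num.Theory.
Import numFieldNormedType.Exports.

Local Open Scope classical_set_scope.
Local Open Scope ring_scope.
Local Open Scope ereal_scope.

Section lebesgue_measure_rV.
Context {R : realType} {n : nat}.
Implicit Types (a b : 'rV[R]_n) (A X : set 'rV[R]_n).

Definition box a b : set 'rV[R]_n :=
  [set x | forall i : 'I_n, (a ord0 i < x ord0 i <= b ord0 i)%R].

Definition box_volume a b : R :=
  (\prod_(i < n) Num.max 0 (b ord0 i - a ord0 i))%R.

(* The families are indexed by a subset D of nat, so that they may be finite or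
   empty: for n = 0 the empty set is not a box. *)
Definition rV_outer_measure A : \bar R :=
  ereal_inf [set v | exists D : set nat, exists a b : nat -> 'rV[R]_n,
    A `<=` \bigcup_(k in D) box (a k) (b k) /\
    v = \esum_(k in D) (box_volume (a k) (b k))%:E].

Let box_volume_ge0 a b : 0 <= (box_volume a b)%:E.
Proof. by rewrite lee_fin; apply: prodr_ge0 => i _; rewrite le_max lexx. Qed.

Let outer_ge0 A : 0 <= rV_outer_measure A.
Proof.
apply: le_ereal_inf_tmp => _ [D [a [b [_ ->]]]].
by apply: esum_ge0 => k _; exact: box_volume_ge0.
Qed.

Let outer0 : rV_outer_measure set0 = 0.
Proof.
apply/eqP; rewrite eq_le outer_ge0 andbT; apply: ereal_inf_lbound.
by exists set0, (fun=> 0%R), (fun=> 0%R); rewrite esum_set0; split.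
Qed.

Let le_outer : {homo rV_outer_measure : A B / A `<=` B >-> A <= B}.
Proof.
move=> A B AB; apply: ereal_inf_le_tmp => _ [D [a [b [BD ->]]]].
by exists D, a, b; split=> //; exact: subset_trans BD.
Qed.

Let outer_sigma_subadditive : sigma_subadditive rV_outer_measure.
Proof.
move=> A; have [[i ioo]|] := pselect (exists i, rV_outer_measure (A i) = +oo).
  rewrite (eseries_pinfty _ _ ioo) ?leey// => m _.
  by rewrite -ltNye (lt_le_trans _ (outer_ge0 _)).
rewrite -forallNE => Aoo.
suff add2e (e : {posnum R}) :
    rV_outer_measure (\bigcup_m A m) <=
    \sum_(i <oo) rV_outer_measure (A i) + e%:num%:E.
  by apply/lee_addgt0Pr => _/posnumP[].
rewrite (le_trans _ (epsilon_trick _ _ _))//.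
pose vol (G : set nat * (nat -> 'rV[R]_n) * (nat -> 'rV[R]_n)) k :=
  (box_volume (G.1.2 k) (G.2 k))%:E.
pose P m (G : set nat * (nat -> 'rV[R]_n) * (nat -> 'rV[R]_n)) :=
  A m `<=` \bigcup_(k in G.1.1) box (G.1.2 k) (G.2 k) /\
  \esum_(k in G.1.1) vol G k <=
    rV_outer_measure (A m) + (e%:num / (2 ^ m.+1)%:R)%:E.
have [G PG] : {G & forall m, P m (G m)}.
  apply: (@choice _ _ P) => m.
  have fin : rV_outer_measure (A m) \is a fin_num.
    by rewrite ge0_fin_numE// ltey; apply/eqP; exact: Aoo.
  have e0 : (0 < e%:num / (2 ^ m.+1)%:R)%R by [].
  have [_ [D [a [b [AD ->]]]] lt] := lb_ereal_inf_adherent e0 fin.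
  by exists (D, a, b); split=> //; exact: ltW.
have vol0 m k : 0 <= vol (G m) k by exact: box_volume_ge0.
apply: (@le_trans _ _ (\sum_(m <oo) \esum_(k in (G m).1.1) vol (G m) k)).
  rewrite nneseries_esumT; last by move=> m; exact: esum_ge0.
  rewrite esum_esum//; apply: ereal_inf_lbound.
  have /card_esym/ppcard_eqP[f] := card_nat2.
  exists (f @^-1` ([set: nat] `*`` (fun m => (G m).1.1))).
  exists (fun k => (G (f k).1).1.2 (f k).2), (fun k => (G (f k).1).2 (f k).2).
  split.
    move=> x [m _ /(PG m).1 [k Dk xk]].
    by exists (f^-1%FUN (m, k)); rewrite /= invK ?inE.
  rewrite (@reindex_esum _ _ _
    (f @^-1` ([set: nat] `*`` (fun m => (G m).1.1))) _ f)//.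
  split=> //.
    by move=> i j _ _ /(@inj _ _ _ f); apply; rewrite inE.
  by move=> y Dy; exists (f^-1%FUN y); rewrite /= invK ?inE.
apply: lee_nneseries => m *; first exact: esum_ge0.
exact: (PG m).2.
Qed.

HB.instance Definition _ := isOuterMeasure.Build R 'rV[R]_n rV_outer_measure
  outer0 outer_ge0 le_outer outer_sigma_subadditive.

End lebesgue_measure_rV.
Arguments rV_outer_measure R n : clear implicits.

(* R^n with the sigma-algebra of Lebesgue-measurable (not merely Borel) sets:
   a log-concave function need not be Borel measurable. *)
Notation lebesgue_rV R n := (caratheodory_type (rV_outer_measure R n)).

Definition lebesgue_measure_rV (R : realType) (n : nat) :
  set (lebesgue_rV R n) -> \bar R := rV_outer_measure R n.
HB.instance Definition _ (R : realType) (n : nat) :=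
  isMeasure.Build _ (lebesgue_rV R n) R (@lebesgue_measure_rV R n)
    (@caratheodory_measure0 _ _ (rV_outer_measure R n))
    (@caratheodory_measure_ge0 _ _ (rV_outer_measure R n))
    (@caratheodory_measure_sigma_additive _ _ (rV_outer_measure R n)).

(* R^n with the sigma-algebra of all subsets, on which G_n is defined. *)
Definition discrete_rV (R : realType) (n : nat) := 'rV[R]_n.
HB.instance Definition _ R n := Pointed.on (discrete_rV R n).
HB.instance Definition _ R n := @isMeasurable.Build default_measure_display
  (discrete_rV R n) discrete_measurable discrete_measurable0
  discrete_measurableC discrete_measurableU.

Definition integer_lattice (R : realType) (n : nat) : set 'rV[R]_n :=
  [set x | forall i : 'I_n, x ord0 i \is a Num.int].

Definition lattice_enumerator (R : realType) (n : nat)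
  (A : set (discrete_rV R n)) : \bar R := counting (A `&` @integer_lattice R n).

HB.instance Definition _ R n := Measure.copy (@lattice_enumerator R n)
  (mrestr (@counting (discrete_rV R n) R)
     (Logic.I : measurable (@integer_lattice R n : set (discrete_rV R n)))).

Section log_concave.
Context {R : realType} {n : nat}.
Implicit Types (f g : 'rV[R]_n -> R).

(* For u with values in (-oo, +oo]; by the convention 0 * +oo = 0 the
   inequality holds automatically at t = 0 and t = 1. *)
Definition econvex (u : 'rV[R]_n -> \bar R) : Prop :=
  forall (x y : 'rV[R]_n) (t : R), (0 <= t <= 1)%R ->
    u (t *: x + (1 - t) *: y)%R <= t%:E * u x + (1 - t)%:E * u y.

Definition log_concave f : Prop :=
  exists u : 'rV[R]_n -> \bar R,
    [/\ forall x, u x != -oo, econvex u & forall x, (f x)%:E = expeR (- u x)].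

(* The class F(R^n). *)
Definition integrable_log_concave f : Prop :=
  [/\ log_concave f,
      (@lebesgue_measure_rV R n).-integrable setT
        (fun x : lebesgue_rV R n => (f x)%:E) &
      0 < \int[@lebesgue_measure_rV R n]_x (f x)%:E].

Definition sup_norm f : \bar R := ereal_sup (range (fun x => (f x)%:E)).

Definition asplund f g (x : 'rV[R]_n) : \bar R :=
  ereal_sup (range (fun z => (f z * g (x - z)%R)%:E)).

Definition reflection f : 'rV[R]_n -> R := fun x => f (- x)%R.

End log_concave.

Definition open_cube (R : realType) (n : nat) : set 'rV[R]_n :=
  [set x | forall i : 'I_n, (-1 < x ord0 i < 1)%R].

Definition scaled_open_cube (R : realType) (n : nat) (r : R) : set 'rV[R]_n :=
  [set (r *: x)%R | x in @open_cube R n].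

(* Main.v *)
Require Import Defs.
From mathcomp Require Import all_boot all_order all_algebra.
From mathcomp Require Import all_classical all_reals all_analysis.
From mathcomp Require Import measurable_realfun zify ring lra.

(* Let M = sup f and K_t = {f > t}. Since f <= M, f(x) f(x - z) > M t forces
   both factors above t, so {f * f~ > M t} is contained in K_t - K_t, whereas
   K_t + (3/4) C_n is contained in {f * chi > t}. A layer-cake comparison thus
   reduces the claim to #(K - K) <= C(2n,n) #(K + (3/4) C_n) for K convex, where
   # counts lattice points. Put A = K + (1/4) C_n. Counting the pairs of lattice
   points of k A by their difference, as in the proof of the Rogers-Shephard
   inequality, and letting k grow yields a d <= C(2n,n) b^2, where a and b bound
   the number of points of all translates of A from below and from above, and
   k (A - A) has at least d k^n points. Apply this to l A: its translates have
   asymptotically equal numbers of points, at most l^n #(K + (3/4) C_n), while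
   A - A contains K - K + (1/2) C_n, so that d = (l - 1)^n #(K - K). Let l grow. *)

Set Implicit Arguments.
Unset Strict Implicit.
Unset Printing Implicit Defensive.

(** * Binomial sums and inequalities between powers of natural numbers *)

Lemma sum_bin_shift (q k : nat) : \sum_(i < k) 'C(k.-1 - i, q) = 'C(k, q.+1).
Proof.
elim: k => [|k IH]; first by rewrite big_ord0.
rewrite big_ord_recl /= subn0 binS addnC; congr addn.
by rewrite -IH; apply: eq_bigr => i _; congr ('C(_, q)); rewrite /bump /=; lia.
Qed.

(** Both sides count the subsets of [{0, ..., k - 1}] of size [p + q + 1], the left one by their
    element [i] of rank [p + 1]; the induction uses Pascal's rule. *)
Lemma sum_bin_mul_bin (p q k : nat) :
  \sum_(i < k) 'C(i, p) * 'C(k.-1 - i, q) = 'C(k, (p + q).+1).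
Proof.
elim: k p => [|k IH] p; first by rewrite big_ord0.
case: p => [|p].
  by rewrite -sum_bin_shift; apply: eq_bigr => i _; rewrite bin0 mul1n.
rewrite big_ord_recl /= mul0n add0n addSn binS -addSn -!IH -big_split /=.
apply: eq_bigr => i _; rewrite /bump /= add1n binS mulnDl.
by have -> : k - i.+1 = k.-1 - i by lia.
Qed.

Lemma ffact_leq_expn (m n : nat) : m ^_ n <= m ^ n.
Proof.
elim: n m => [|n IH] m //; rewrite ffactnSr expnSr.
by apply: leq_mul; [exact: IH | exact: leq_subr].
Qed.

Lemma expn_leq_ffact (m n : nat) : m ^ n <= (m + n) ^_ n.
Proof.
elim: n => [|n IH] //; rewrite addnS ffactSS expnS.
by apply: leq_mul => //; lia.
Qed.

(** Bernoulli's inequality [(1 - 1 / (m + 1))^p >= 1 - p / (m + 1)], cleared of denominators. *)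
Lemma bernoulli_expn (m p : nat) :
  m.+1 ^ p * m.+1 <= m ^ p * m.+1 + p * m.+1 ^ p.
Proof.
elim: p => [|p IH]; first by lia.
have le : m ^ p <= m.+1 ^ p by case: (p) => // p'; rewrite leq_exp2r //.
rewrite !expnS; nia.
Qed.

(* Along [k = (c + 1) N] the hypothesis gives [N^p x <= (N + 1)^p y], and
   [((N + 1) / N)^p] tends to 1. *)
Lemma leq_of_leq_expn (x y p c : nat) :
  (forall k, 0 < k -> k ^ p * x <= (k + c) ^ p * y) -> x <= y.
Proof.
move=> H; rewrite leqNgt; apply/negP => yx.
(* Makes the error term [p x] of Bernoulli's inequality less than [N + 1], which contradicts
   [y + 1 <= x]. *)
pose N := (p * x).+1.
have HN : N ^ p * x <= N.+1 ^ p * y.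
  have /H : 0 < c.+1 * N by rewrite muln_gt0.
  have le : (c.+1 * N + c) ^ p <= (c.+1 * N.+1) ^ p.
    by case: (p) => // p'; rewrite leq_exp2r //; lia.
  move=> /leq_trans /(_ (leq_mul le (leqnn y))).
  by rewrite !expnMn -!mulnA leq_pmul2l // expn_gt0.
have := bernoulli_expn N p.
have E0 : 0 < N.+1 ^ p by rewrite expn_gt0.
move: HN E0; set E := N.+1 ^ p; set F := N ^ p => HN E0 HB.
have : E * (N.+1 * x) <= E * (N.+1 * y + p * x) by nia.
by rewrite leq_pmul2l //; rewrite /N; nia.
Qed.

Lemma sum_bin_from (q k j : nat) : (j <= k)%N ->
  \sum_(i < k | j <= i) 'C(k.-1 - i, q) = 'C(k - j, q.+1).
Proof.
move=> jk; have := big_geq_mkord j k predT (fun i => 'C(k.-1 - i, q)).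
rewrite /= => <-; rewrite -[j in LHS]add0n big_addn big_mkord -sum_bin_shift.
by apply: eq_bigr => i _; congr ('C(_, q)); lia.
Qed.

Lemma size_pairs_leq (T T' : eqType) (s : seq (T * T')) (N N' : nat) :
  uniq s ->
  (size (undup [seq p.1 | p <- s]) <= N)%N ->
  (size (undup [seq p.2 | p <- s]) <= N')%N -> (size s <= N * N')%N.
Proof.
move=> us sN sN'; apply: leq_trans (leq_mul sN sN').
rewrite -(size_allpairs pair); apply: uniq_leq_size => // -[x y] xys.
apply/allpairsP; exists (x, y); split=> //=.
  by rewrite mem_undup; apply/mapP; exists (x, y).
by rewrite mem_undup; apply/mapP; exists (x, y).
Qed.

Lemma euclid_inj (m a b : nat) (x y : int) : (a < m)%N -> (b < m)%N ->
  (x * m%:Z + a%:Z = y * m%:Z + b%:Z)%R -> x = y /\ a = b.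
Proof.
move=> am bm e; have xy : x = y.
  apply/eqP; rewrite Order.POrderTheory.eq_le; apply/andP.
  by split; rewrite Order.TotalTheory.leNgt; apply/negP => h; nia.
by split=> //; move: e; rewrite xy => /GRing.addrI -[].
Qed.

Import Order.TTheory GRing.Theory Num.Theory.
Local Open Scope classical_set_scope.
Local Open Scope ring_scope.

(** * Lattice points of translates and of dilates *)

Section counting.
Context {R : realType} {n : nat}.
Implicit Types (S A K : set 'rV[R]_n) (v w : 'rV[R]_n) (z : 'rV[int]_n).

Definition lattice_point z : 'rV[R]_n := map_mx intr z.

(* Bounds on the number of lattice points are stated with duplicate-free lists,
   so that no finiteness has to be known beforehand. *)
Definition atleast S (N : nat) := exists s : seq 'rV[int]_n,
  [/\ uniq s, {in s, forall z, S (lattice_point z)} & (N <= size s)%N].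

Definition atmost S (N : nat) := forall s : seq 'rV[int]_n,
  uniq s -> {in s, forall z, S (lattice_point z)} -> (size s <= N)%N.

Definition dilate (k : nat) v S : set 'rV[R]_n := [set k%:R *: x + v | x in S].

Lemma sub_atleast S S' N : S `<=` S' -> atleast S N -> atleast S' N.
Proof. by move=> SS' [s [us Ss sN]]; exists s; split=> // z /Ss /SS'. Qed.

Lemma atleast_leq S N N' : (N' <= N)%N -> atleast S N -> atleast S N'.
Proof. by move=> NN' [s [us Ss sN]]; exists s; split=> //; exact: leq_trans sN. Qed.

Lemma sub_atmost S S' N : S `<=` S' -> atmost S' N -> atmost S N.
Proof. by move=> SS' S'N s us Ss; apply: S'N => // z /Ss /SS'. Qed.

Lemma atleast_atmost S N M : atleast S N -> atmost S M -> (N <= M)%N.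
Proof. by move=> [s [us Ss sN]] /(_ s us Ss); exact: leq_trans. Qed.

Lemma lattice_pointB z z' :
  lattice_point (z - z') = lattice_point z - lattice_point z'.
Proof. exact: raddfB. Qed.

Lemma lattice_pointD z z' :
  lattice_point (z + z') = lattice_point z + lattice_point z'.
Proof. exact: raddfD. Qed.

Lemma lattice_pointN z : lattice_point (- z) = - lattice_point z.
Proof. exact: raddfN. Qed.

Lemma atleast_shift S z0 N :
  atleast [set x | S (x + lattice_point z0)] N -> atleast S N.
Proof.
move=> [s [us Ss sN]]; exists [seq z + z0 | z <- s]; split.
- by rewrite map_inj_uniq //; exact: addIr.
- by move=> _ /mapP[z /Ss Sz ->]; rewrite lattice_pointD.
- by rewrite size_map.
Qed.

Lemma atmost_shift S z0 N :
  atmost [set x | S (x + lattice_point z0)] N -> atmost S N.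
Proof.
move=> SN s us Ss.
have -> : size s = size [seq z - z0 | z <- s] by rewrite size_map.
apply: SN; first by rewrite map_inj_uniq //; exact: addIr.
by move=> _ /mapP[z /Ss Sz ->] /=; rewrite -lattice_pointD subrK.
Qed.

Section cosets.
Context (k' : nat).
Let k := k'.+1.

Let quot z : 'rV[int]_n := \row_i (z ord0 i %/ k%:Z)%Z.
Let res z : 'rV['I_k]_n := \row_i inord `|(z ord0 i %% k%:Z)%Z|%N.
Let glue (c : 'rV['I_k]_n) (q : 'rV[int]_n) : 'rV[int]_n :=
  \row_i (q ord0 i * k%:Z + (c ord0 i : nat)%:Z).
Let off (c : 'rV['I_k]_n) : 'rV[R]_n := \row_i (c ord0 i : nat)%:R.

Let glueK z : glue (res z) (quot z) = z.
Proof.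
apply/rowP => i; rewrite !mxE.
have k0 : (0 : int) < k%:Z by [].
have lt := ltz_pmod (z ord0 i) k0.
have ge : 0 <= (z ord0 i %% k%:Z)%Z by rewrite modz_ge0.
by rewrite inordK ?gez0_abs -?divz_eq //; lia.
Qed.

Let glue_inj c c' q q' : glue c q = glue c' q' -> c = c' /\ q = q'.
Proof.
move=> /rowP E; suff H i : c ord0 i = c' ord0 i /\ q ord0 i = q' ord0 i.
  by split; apply/rowP => i; have [] := H i.
move: (E i); rewrite !mxE => /euclid_inj[] // -> /val_inj ->.
by split.
Qed.

Let pointE c q :
  lattice_point (glue c q) = k%:R *: lattice_point q + off c.
Proof.
by apply/rowP => i; rewrite !mxE rmorphD rmorphM /= mulrC.
Qed.

Let dilate_glue S v c q :
  dilate k v S (lattice_point (glue c q)) <->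
  dilate 1 (k%:R^-1 *: (v - off c)) S (lattice_point q).
Proof.
have k0 : k%:R != 0 :> R by rewrite pnatr_eq0.
rewrite pointE; split => -[x Sx] E; exists x => //.
  rewrite scale1r; apply: (scalerI k0).
  by rewrite scalerDr scalerA mulfV // scale1r addrA E addrK.
by rewrite -E scale1r scalerDr scalerA mulfV // scale1r addrA subrK.
Qed.

(** The lattice splits into [k ^ n] residue classes modulo [k]. On the class of [c], division by [k]
    turns the points of [k S + v] into those of the translate of [S] by [(v - c) / k]. The lower
    bound below has the same reason. *)
Lemma atmost_dilate S N : (forall v, atmost (dilate 1 v S) N) ->
  forall v, atmost (dilate k v S) (k ^ n * N)%N.
Proof.
move=> SN v s us Ss.
have -> : size s = (\sum_(c : 'rV['I_k]_n) size [seq z <- s | res z == c])%N.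
  rewrite -sum1_size (partition_big res predT) //=; apply: eq_bigr => c _.
  by rewrite size_filter -sum1_count.
have -> : (k ^ n * N = \sum_(c : 'rV['I_k]_n) N)%N.
  by rewrite sum_nat_const card_mx card_ord mul1n.
apply: leq_sum => c _; rewrite -(size_map quot).
apply: (SN (k%:R^-1 *: (v - off c))).
  rewrite map_inj_in_uniq ?filter_uniq // => z z'.
  rewrite !mem_filter => /andP[/eqP zc _] /andP[/eqP z'c _] E.
  by rewrite -(glueK z) -(glueK z') zc z'c E.
move=> q /mapP[z]; rewrite mem_filter => /andP[/eqP zc /Ss] + -> /=.
by rewrite -{1}(glueK z) zc => /dilate_glue.
Qed.

Lemma atleast_dilate S N : (forall v, atleast (dilate 1 v S) N) ->
  forall v, atleast (dilate k v S) (k ^ n * N)%N.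
Proof.
move=> SN v.
have /choice[X HX] : forall c : 'rV['I_k]_n, exists s : seq 'rV[int]_n,
    [/\ uniq s, {in s, forall q, dilate k v S (lattice_point (glue c q))} &
    (N <= size s)%N].
  move=> c; have [s [us Ss sN]] := SN (k%:R^-1 *: (v - off c)).
  by exists s; split=> // q /Ss /dilate_glue.
exists [seq glue c q | c <- enum 'rV['I_k]_n, q <- X c]; split.
- apply: allpairs_uniq_dep; first exact: enum_uniq.
    by move=> c _; have [] := HX c.
  by move=> [c q] [c' q'] _ _ /= /glue_inj[-> ->].
- by move=> z /allpairsPdep[c [q [_ qX ->]]]; have [_ + _] := HX c; exact.
- rewrite size_allpairs_dep sumnE big_map big_enum /=.
  have -> : (k ^ n * N = \sum_(c : 'rV['I_k]_n) N)%N.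
    by rewrite sum_nat_const card_mx card_ord mul1n.
  by apply: leq_sum => c _; have [] := HX c.
Qed.

End cosets.

End counting.

(** * A Rogers-Shephard inequality for lattice points *)

Section rogers_shephard.
Context {R : realType} {n : nat}.
Implicit Types (S A K : set 'rV[R]_n) (v w : 'rV[R]_n) (z : 'rV[int]_n).

Definition is_convex A := forall (x y : 'rV[R]_n) (t : R), 0 <= t <= 1 ->
  A x -> A y -> A (t *: x + (1 - t) *: y).

Definition difference_body A : set 'rV[R]_n :=
  [set p | exists x y, [/\ A x, A y & p = x - y]].

Lemma dilate_comp A j k v w : dilate j w (dilate k v A) = dilate (j * k) (j%:R *: v + w) A.
Proof.
apply/seteqP; split => x.
  move=> [_ [y Ay <-] <-]; exists y => //.
  by rewrite scalerDr scalerA natrM addrA.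
move=> [y Ay <-]; exists (k%:R *: y + v); first by exists y.
by rewrite scalerDr scalerA natrM addrA.
Qed.

Lemma convex_dilateD A (j k : nat) x y : is_convex A -> A x -> A y ->
  (0 < j + k)%N -> dilate (j + k) 0 A (j%:R *: x + k%:R *: y).
Proof.
move=> cA Ax Ay jk.
have jk0 : (j + k)%:R != 0 :> R by rewrite pnatr_eq0 -lt0n.
have jkp : 0 < (j + k)%:R :> R by rewrite ltr0n.
exists ((j%:R / (j + k)%:R) *: x + (1 - j%:R / (j + k)%:R) *: y).
  apply: cA => //; rewrite divr_ge0 ?ler0n //=.
  by rewrite ler_pdivrMr // mul1r ler_nat leq_addr.
rewrite addr0 scalerDr !scalerA; congr (_ *: _ + _ *: _).
  by rewrite mulrCA mulfV // mulr1.
by rewrite mulrBr mulr1 mulrCA mulfV // mulr1 natrD addrC addKr.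
Qed.

(* If [z = j (x - y)], then [p] may be any point of the translate
   [(k - j) A + j x] of [(k - j) A]. *)
Lemma atleast_pairs A (a j k : nat) z : is_convex A ->
  (forall v, atleast (dilate 1 v A) a) -> (j < k)%N ->
  dilate j 0 (difference_body A) (lattice_point z) ->
  atleast [set p | dilate k 0 A p /\ dilate k 0 A (p - lattice_point z)]
    ((k - j) ^ n * a)%N.
Proof.
move=> cA Aa jk [_ [x [y [Ax Ay ->]]]]; rewrite addr0 => zE.
have kj : (k - j = (k - j).-1.+1)%N by lia.
rewrite kj; apply: sub_atleast (atleast_dilate (k - j).-1 Aa (j%:R *: x)) => _ [u Au <-] /=.
(* For [p = (k - j) u + j x] one has [p - z = (k - j) u + j y]; convexity puts both in [k A]. *)
rewrite -zE -kj scalerBr opprB [_ - j%:R *: x]addrC addrA addrK.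
by rewrite -{1 3}(subnK (ltnW jk)); split; apply: convex_dilateD => //; lia.
Qed.

(** Double counting of the pairs of lattice points of [k A]: there are at most [(k ^ n b) ^ 2],
    while a difference in [j (A - A)] arises from at least [(k - j) ^ n a] of them. *)
Lemma lattice_rogers_shephard_at A (a b d k : nat) : is_convex A ->
  (0 < n)%N -> (0 < k)%N ->
  (forall v, atleast (dilate 1 v A) a) ->
  (forall v, atmost (dilate 1 v A) b) ->
  (forall i, (0 < i)%N ->
     atleast (dilate i 0 (difference_body A)) (i ^ n * d)) ->
  (k ^_ (2 * n) * (a * d) <= k ^ (2 * n) * ('C(2 * n, n) * b ^ 2))%N.
Proof.
move=> cA n0 k0 Aa Ab Dd.
have /choice[X HX] : forall i : 'I_k, exists s : seq 'rV[int]_n, [/\ uniq s,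
    {in s, forall z, dilate i 0 (difference_body A) (lattice_point z)} &
    (i ^ n * d <= size s)%N].
  move=> i; have [i0|/Dd //] := posnP i.
  by exists [::]; rewrite i0 exp0n.
(* These weights satisfy [\sum_(i >= j) w i = (k - j) ^_ n <= (k - j)^n], so that
   weighting the points of [i (A - A)] by [w i], for every [i], never exceeds
   the number of pairs, and [\sum_i w i * i ^_ n = n!^2 C(k, 2n)]. *)
pose w (i : 'I_k) := (n`! * 'C(k.-1 - i, n.-1))%N.
have /choice[Y HY] : forall z, exists s : seq 'rV[int]_n, [/\ uniq s,
    {in s, forall p, dilate k 0 A (lattice_point p) /\
      dilate k 0 A (lattice_point (p - z))} &
    (a * (\sum_(i < k | z \in X i) w i) <= size s)%N].
  move=> z; have [[i0 zi0]|noz] := pselect (exists i, z \in X i); last first.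
    by exists [::]; rewrite big1 ?muln0 // => i zi; case: noz; exists i.
  (* The least [j] gives the most pairs, and all other [i] with [z] in [X i] lie above it. *)
  case: (@arg_minnP _ i0 (fun i => z \in X i) (fun i : 'I_k => i : nat) zi0) => j zj jmin.
  have [_ XD _] := HX j.
  have [s [us Hs ss]] := atleast_pairs cA Aa (ltn_ord j) (XD z zj).
  exists s; split=> //; first by move=> p /Hs; rewrite /= lattice_pointB.
  apply: leq_trans ss; rewrite mulnC leq_mul2r; apply/orP; right.
  apply: leq_trans (ffact_leq_expn _ _); rewrite -bin_ffact mulnC.
  have -> : 'C(k - j, n) = 'C(k - j, n.-1.+1) by rewrite prednK.
  rewrite -sum_bin_from; last exact: ltnW.
  rewrite big_distrr /=; apply: (leq_trans (n := (\sum_(i < k | (j <= i)%N) w i)%N)) => //.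
  rewrite big_mkcond [X in (_ <= X)%N]big_mkcond /=; apply: leq_sum => i _.
  by case: ifP => // zi; rewrite jmin.
pose Z := undup (flatten [seq X i | i <- enum 'I_k]).
pose P := [seq (p, p - z) | z <- Z, p <- Y z].
have uP : uniq P.
  apply: allpairs_uniq_dep; first exact: undup_uniq.
    by move=> z _; have [] := HY z.
  by move=> [z p] [z' p'] _ _ /= [-> /addrI/oppr_inj ->].
have PA (q : 'rV[int]_n * 'rV[int]_n) : q \in P -> dilate k 0 A (lattice_point q.1) /\
    dilate k 0 A (lattice_point q.2).
  by move=> /allpairsPdep[z [p [_ pY ->]]] /=; have [_ + _] := HY z; exact.
have kb : atmost (dilate k 0 A) (k ^ n * b).
  by rewrite -(prednK k0); exact: atmost_dilate.
have Pb : (size P <= (k ^ n * b) * (k ^ n * b))%N.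
  by apply: size_pairs_leq => //; apply: kb; rewrite ?undup_uniq // => z;
    rewrite mem_undup => /mapP[q /PA [q1 q2] ->].
have Pa : (a * (\sum_(i < k) w i * (i ^ n * d)) <= size P)%N.
  rewrite size_allpairs_dep sumnE big_map.
  apply: (@leq_trans (\sum_(z <- Z) a * (\sum_(i < k | z \in X i) w i))%N); last first.
    by apply: leq_sum => z _; have [] := HY z.
  rewrite -big_distrr /= leq_mul2l; apply/orP; right.
  (* After the exchange, [w i] is counted once for every point of [X i]. *)
  rewrite (exchange_big_dep predT) //=; apply: leq_sum => i _.
  have [uX _ Xs] := HX i.
  rewrite big_const_seq iter_addn_0 -size_filter leq_mul2l; apply/orP; right.
  apply: leq_trans Xs _; apply: uniq_leq_size => // z zX.
  rewrite mem_filter zX mem_undup /=; apply/flatten_mapP.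
  by exists i; rewrite ?mem_enum.
have key : (a * d * (n`! * n`! * 'C(k, 2 * n)) <= size P)%N.
  apply: leq_trans Pa; rewrite -mulnA leq_mul2l; apply/orP; right.
  have -> : (2 * n = (n + n.-1).+1)%N by lia.
  rewrite -sum_bin_mul_bin !big_distrr /=; apply: leq_sum => i _.
  have := leq_mul (leqnn (d * n`! * 'C(k.-1 - i, n.-1))) (ffact_leq_expn i n).
  by rewrite -bin_ffact /w; congr (_ <= _)%N; lia.
(* The factor ['C(2 * n, n)] turns [n!^2 'C(k, 2 * n)] into the falling factorial [k ^_ (2 * n)]. *)
have fE : ('C(2 * n, n) * (n`! * n`!) = (2 * n)`!)%N.
  by rewrite mul2n -addnn -[X in (_ * (_ * X`!))%N](addnK n) bin_fact ?leq_addr.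
rewrite -bin_ffact -fE.
have -> : (k ^ (2 * n) = k ^ n * k ^ n)%N by rewrite mul2n -addnn expnD.
have := leq_mul (leqnn 'C(2 * n, n)) (leq_trans key Pb).
by congr (_ <= _)%N; lia.
Qed.

(** The limit of the preceding bound along [k = m + 2 n], where [k ^_ (2 * n)] is at least
    [m ^ (2 * n)]. *)
Lemma lattice_rogers_shephard A (a b d : nat) : is_convex A ->
  (forall v, atleast (dilate 1 v A) a) ->
  (forall v, atmost (dilate 1 v A) b) ->
  (forall i, (0 < i)%N ->
     atleast (dilate i 0 (difference_body A)) (i ^ n * d)) ->
  (a * d <= 'C(2 * n, n) * b ^ 2)%N.
Proof.
move=> cA Aa Ab Dd; have [n0|n0] := posnP n.
  (* In dimension 0 the only point is the origin, so [a] and [d] are at most 1, and [a <= b]. *)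
  have le1 S N : atleast S N -> (N <= 1)%N.
    move=> [s [us _ /leq_trans]]; apply.
    rewrite (@uniq_leq_size _ s [:: 0]) // => z _; rewrite inE; apply/eqP.
    by apply/rowP => i; have := ltn_ord i; rewrite {2}n0.
  have a1 := le1 _ _ (Aa 0); have d1 := le1 _ _ (Dd 1%N isT).
  rewrite exp1n mul1n in d1; have ab := atleast_atmost (Aa 0) (Ab 0).
  have C0 : (0 < 'C(2 * n, n))%N by rewrite bin_gt0; lia.
  nia.
apply: (@leq_of_leq_expn _ _ (2 * n) (2 * n)) => m m0.
apply: leq_trans (lattice_rogers_shephard_at (k := m + 2 * n) cA n0 _ Aa Ab Dd).
  by rewrite leq_mul2r expn_leq_ffact orbT.
by rewrite addn_gt0 m0.
Qed.

End rogers_shephard.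

(** * Lattice points of the difference body of a convex set *)

Section difference_body_lattice.
Context {R : realType} {n : nat}.
Implicit Types (S A K : set 'rV[R]_n) (v w : 'rV[R]_n) (z : 'rV[int]_n).

(** The Minkowski sum [K + r C_n]. *)
Definition thicken (r : R) K : set 'rV[R]_n :=
  [set x | exists2 y, K y & forall i, `|x ord0 i - y ord0 i| < r].

Lemma convex_thicken r K : is_convex K -> is_convex (thicken r K).
Proof.
move=> cK x x' t t01 [y Ky xy] [y' Ky' xy'].
exists (t *: y + (1 - t) *: y'); first exact: cK.
move=> i; move: (xy i) (xy' i) t01; rewrite !mxE !ltr_norml.
move: (x _ _) (x' _ _) (y _ _) (y' _ _) => a a' b b' /andP[H1 H2] /andP[H3 H4] /andP[t0 t1].
(* A strict inequality survives multiplication only by a positive weight, so [t = 0] is separate. *)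
have [->|t0'] := eqVneq t 0; first by apply/andP; split; lra.
have tp : 0 < t by rewrite lt_neqAle eq_sym t0' t0.
by apply/andP; split; nra.
Qed.

Lemma convex_dilate k v A : is_convex A -> is_convex (dilate k v A).
Proof.
move=> cA _ _ t t01 [x Ax <-] [y Ay <-].
exists (t *: x + (1 - t) *: y); first exact: cA.
apply/rowP => i; rewrite !mxE; ring.
Qed.

Lemma sub_thicken r K : 0 < r -> K `<=` thicken r K.
Proof. by move=> r0 x Kx; exists x => // i; rewrite subrr normr0. Qed.

Let floor_row v : 'rV[int]_n := \row_i Num.floor (v ord0 i).

Let floor_rowP v i : 0 <= (v - lattice_point (floor_row v)) ord0 i < 1.
Proof.
rewrite !mxE; have /andP[h1 h2] := floor_itv (v ord0 i).
by move: h2; rewrite intrD subr_ge0 h1 ltrBlDl addrC.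
Qed.

(** Modulo the lattice, [v] can be moved into [[-1/2, 1/2)^n], and [1/4 + 1/2 = 3/4]: this is the
    source of the constant [3/4]. *)
Lemma atmost_translate_thicken K (g : nat) :
  atmost (thicken (3 / 4) K) g ->
  forall v, atmost (dilate 1 v (thicken (1 / 4) K)) g.
Proof.
move=> Kg v; pose u := v + const_mx (1 / 2).
apply: (atmost_shift (z0 := floor_row u)); apply: sub_atmost Kg => x /= [a [y Ky ay]].
rewrite scale1r => E; exists y => // i; move: (ay i) (floor_rowP u i).
have -> : x = a + v - lattice_point (floor_row u) by rewrite E addrK.
by rewrite !mxE !ltr_norml => /andP[? ?] /andP[? ?]; apply/andP; split; lra.
Qed.

(* A translate of [l A] can be moved by a lattice vector into any given
   translate of [(l + 4) A], because [4 A] contains a cube of side 2. *)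
Lemma atleast_widen K (l N : nat) v : is_convex K -> K !=set0 ->
  atleast (dilate l v (thicken (1 / 4) K)) N ->
  forall w, atleast (dilate (l + 4) w (thicken (1 / 4) K)) N.
Proof.
move=> cK [p Kp] lN w; pose u := v - w - 4 *: p.
apply: (atleast_shift (z0 := - floor_row u)).
apply: sub_atleast lN => _ [a Aa <-] /=; rewrite lattice_pointN.
(* Since [c] lies in [[0, 1)^n], the point [p + c / 4] is in the thickened set [A], and [4 p + c] is
   in [4 A]. *)
pose c := u - lattice_point (floor_row u).
have Ac : thicken (1 / 4) K (p + 4^-1 *: c).
  exists p => // i; have := floor_rowP u i; rewrite -/c; move: c => c; rewrite !mxE.
  by move=> /andP[? ?]; rewrite ltr_norml; apply/andP; split; lra.
have [b Ab E] : dilate (l + 4) 0 (thicken (1 / 4) K) (l%:R *: a + 4 *: (p + 4^-1 *: c)).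
  by apply: convex_dilateD => //; [exact: convex_thicken | rewrite addn4].
exists b => //; move: E; rewrite addr0 => ->.
by apply/rowP => i; rewrite !mxE; field.
Qed.

(** For [z] in [K - K], adding to [L z] a lattice vector with coordinates below [L / 2] in absolute
    value stays in [L (K - K + (1/2) C_n)]. Taking [L - 1] consecutive values per coordinate,
    Euclidean division by [L] keeps the sums distinct. *)
Lemma atleast_dilate_difference_body K (L N : nat) : (0 < L)%N ->
  atleast (difference_body K) N ->
  atleast (dilate L 0 (difference_body (thicken (1 / 4) K))) (L.-1 ^ n * N)%N.
Proof.
move=> L0 [s [us Ks sN]].
(* [- L / 2 < c - h < L / 2] for [0 <= c < L - 1]. *)
pose h := L.-1./2.
pose F z (c : 'rV['I_L.-1]_n) : 'rV[int]_n :=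
  \row_i (z ord0 i * L%:Z + (c ord0 i : nat)%:Z - h%:Z).
exists [seq F z c | z <- s, c <- enum 'rV['I_L.-1]_n]; split.
- apply: allpairs_uniq; rewrite ?enum_uniq // => -[z c] [z' c'] _ _ /= /rowP E.
  suff H i : z ord0 i = z' ord0 i /\ c ord0 i = c' ord0 i.
    by congr pair; apply/rowP => i; have [] := H i.
  move: (E i); rewrite !mxE => /addIr /euclid_inj[].
  + by apply: leq_trans (ltn_ord _) (leq_pred _).
  + by apply: leq_trans (ltn_ord _) (leq_pred _).
  + by move=> -> /val_inj.
- move=> _ /allpairsP[[z c] /= [/Ks [x [y [Kx Ky zE]]] _ ->]].
  have Lr : 0 < L%:R :> R by rewrite ltr0n.
  (* Half of the offset [(c - h) / L]: it is added to [x] and subtracted from [y], both within their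
     [1/4] margin. *)
  pose e : 'rV[R]_n := \row_i (((c ord0 i : nat)%:R - h%:R) / (2 * L%:R)).
  have eP i : `|e ord0 i| < 1 / 4.
    rewrite mxE ltr_norml ltr_pdivlMr ?ltr_pdivrMr ?mulr_gt0 //.
    have := ltn_ord (c ord0 i); move: (c ord0 i : nat) => m mL.
    have h1 : (m + 1 <= L.-1)%N by lia.
    have h2 : (2 * h <= L.-1)%N by rewrite /h; lia.
    have h3 : (L.-1 <= 2 * h + 1)%N by rewrite /h; lia.
    have -> : L%:R = L.-1%:R + 1 :> R by rewrite natr1 prednK.
    have := ler0n R m; move: h1 h2 h3; rewrite -!(ler_nat R) !(natrD, natrM).
    by move=> ? ? ? ?; apply/andP; split; lra.
  exists ((x + e) - (y - e)).
    exists (x + e), (y - e); split=> //.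
      by exists x => // i; have := eP i; move: e {eP} => e; rewrite mxE addrAC subrr add0r.
    exists y => // i; have := eP i; move: e {eP} => e; rewrite !mxE addrAC subrr add0r.
    by rewrite normrN.
  rewrite addr0; apply/rowP => i; move: zE => /rowP/(_ i); rewrite !mxE => zE.
  rewrite !(rmorphD, rmorphM, rmorphN) /= zE; field.
  by rewrite pnatr_eq0; lia.
- by rewrite size_allpairs mulnC -cardE card_mx card_ord mul1n leq_mul2r sN orbT.
Qed.

Lemma dilate1_dilate A l v : dilate 1 v (dilate l 0 A) = dilate l v A.
Proof. by rewrite dilate_comp mul1n scaler0 add0r. Qed.

Lemma dilate_difference_body A i l :
  dilate i 0 (difference_body (dilate l 0 A)) = dilate (i * l) 0 (difference_body A).
Proof.
have E : difference_body (dilate l 0 A) = dilate l 0 (difference_body A).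
  apply/seteqP; split => x.
    move=> [_ [_ [[a Aa <-] [b Ab <-] ->]]]; exists (a - b).
      by exists a, b.
    by rewrite !addr0 scalerBr.
  move=> [_ [a [b [Aa Ab ->]]] <-]; exists (l%:R *: a), (l%:R *: b).
  by split; [exists a | exists b |]; rewrite ?addr0 ?scalerBr.
by rewrite E dilate_comp scaler0 add0r.
Qed.

(** Being bounded, the counts over all translates attain a maximum, which bounds every translate
    from above and one from below. *)
Lemma atmost_dilate_sharp A l (M : nat) : (forall v, atmost (dilate l v A) M) ->
  exists b, (forall v, atmost (dilate l v A) b) /\
    exists v, atleast (dilate l v A) b.
Proof.
move=> AM; pose P N := `[< exists v, atleast (dilate l v A) N >].
have P0 : exists N, P N by exists 0%N; apply/asboolP; exists 0, [::].
have PM N : P N -> (N <= M)%N.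
  by move=> /asboolP[v vN]; exact: atleast_atmost (AM v).
case: (ex_maxnP P0 PM) => b /asboolP Pb bmax; exists b; split=> // v s us sA.
by apply: bmax; apply/asboolP; exists v, s.
Qed.

(** Let [b] and [b'] be the maximal counts for [l A] and [(l + 4) A]. By widening, [b] is also a
    lower bound for every translate of [(l + 4) A], so Rogers-Shephard gives
    [b (l + 3)^n N <= 'C(2 * n, n) b'^2]. One factor [b'] is traded for [b] by [growth], the other
    is at most [(l + 4)^n g]; cancel [b] and let [l] grow. *)
Lemma lattice_difference_body K (g N : nat) : is_convex K ->
  atmost (thicken (3 / 4) K) g -> atleast (difference_body K) N ->
  (N <= 'C(2 * n, n) * g)%N.
Proof.
move=> cK Kg KN; have [->//|N0] := posnP N.
have K0 : K !=set0.
  case: KN => -[|z s] [_ Ks /= sN]; first by lia.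
  by have [x [y [Kx _ _]]] := Ks z (mem_head _ _); exists x.
pose A := thicken (1 / 4) K.
have cA : is_convex A by exact: convex_thicken.
have Ag := atmost_translate_thicken Kg; rewrite -/A in Ag.
have Alg l : (0 < l)%N -> forall v, atmost (dilate l v A) (l ^ n * g).
  by move=> /prednK <-; exact: atmost_dilate.
apply: (@leq_of_leq_expn _ _ (2 * n) 8) => l l0.
have [b [Ab [v bA]]] := atmost_dilate_sharp (Alg l l0).
have l40 : (0 < l + 4)%N by lia.
have [b' [Ab' [v' b'A]]] := atmost_dilate_sharp (Alg _ l40).
have bw := atleast_widen cK K0 bA; rewrite -/A in bw.
have b'w := atleast_widen cK K0 b'A; rewrite -/A in b'w.
(* Some translate of [l A] contains the origin; [b] can then be cancelled. *)
have b0 : (0 < b)%N.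
  have [x Kx] := K0; have Ax : A x by apply: sub_thicken Kx; lra.
  apply: atleast_atmost (Ab (- (l%:R *: x))); exists [:: 0]; split=> // z.
  by rewrite inE => /eqP ->; exists x => //; rewrite subrr /lattice_point raddf0.
have b'g : (b' <= (l + 4) ^ n * g)%N := atleast_atmost b'A (Alg _ l40 _).
have rs : (b * ((l + 3) ^ n * N) <= 'C(2 * n, n) * b' ^ 2)%N.
  apply: (@lattice_rogers_shephard _ _ (dilate (l + 4) 0 A)).
  - exact: convex_dilate.
  - by move=> w; rewrite dilate1_dilate.
  - by move=> w; rewrite dilate1_dilate.
  - move=> i i0; rewrite dilate_difference_body.
    have il : (0 < i * (l + 4))%N by rewrite muln_gt0 i0.
    apply: atleast_leq (atleast_dilate_difference_body il KN).
    rewrite mulnA -expnMn leq_mul2r; apply/orP; right.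
    case: (n) => // m; rewrite leq_exp2r //; nia.
(* Both sides compare with the number of points of [l (l + 8) A]. *)
have growth : (l ^ n * b' <= (l + 8) ^ n * b)%N.
  have [l8 lE] : (l + 8 = (l + 8).-1.+1)%N /\ (l = l.-1.+1)%N by lia.
  apply: (@atleast_atmost _ _ (dilate (l * (l + 8)) 0 A)).
    have := @atleast_dilate _ _ l.-1 (dilate (l + 8) 0 A) b' _ 0.
    rewrite dilate_comp scaler0 addr0 -lE; apply=> w; rewrite dilate1_dilate.
    by have := b'w w; rewrite -addnA.
  have := @atmost_dilate _ _ (l + 8).-1 (dilate l 0 A) b _ 0.
  rewrite dilate_comp scaler0 addr0 -l8 mulnC; apply=> w.
  by rewrite dilate1_dilate.
have step : (b * ((l + 3) ^ n * N * l ^ n) <= b * ('C(2 * n, n) * b' * (l + 8) ^ n))%N.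
  have h1 := leq_mul rs (leqnn (l ^ n)).
  have h2 := leq_mul (leqnn ('C(2 * n, n) * b')) growth.
  apply: leq_trans (leq_trans (_ : _ <= _)%N h2) _; last by rewrite !mulnA; lia.
  by move: h1; congr (_ <= _)%N; lia.
move: step; rewrite leq_pmul2l // => step.
have sq m : (m ^ (2 * n) = m ^ n * m ^ n)%N by rewrite mul2n -addnn expnD.
rewrite !sq.
have e1 : (l ^ n <= (l + 3) ^ n)%N by case: (n) => // m; rewrite leq_exp2r //; lia.
have e2 : ((l + 4) ^ n <= (l + 8) ^ n)%N by case: (n) => // m; rewrite leq_exp2r //; lia.
have h1 := leq_mul (leqnn (N * l ^ n)) e1.
have h2 := leq_mul (leqnn ('C(2 * n, n) * (l + 8) ^ n)) b'g.
have h3 := leq_mul (leqnn ('C(2 * n, n) * (l + 8) ^ n * g)) e2.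
move: h1 h2 h3 step; lia.
Qed.

End difference_body_lattice.

(** * Integrals against the lattice point enumerator as sums *)

Section lattice_integral.
Local Open Scope ereal_scope.
Context {R : realType} {n : nat}.
Implicit Types (z : 'rV[int]_n) (h : discrete_rV R n -> \bar R).

Let mu : {measure set (discrete_rV R n) -> \bar R} := @lattice_enumerator R n.

Lemma lattice_point_inj : injective (@lattice_point R n).
Proof.
move=> z z' /rowP E; apply/rowP => i; have := E i; rewrite !mxE.
exact: intr_inj.
Qed.

Lemma lattice_point_int z : integer_lattice (@lattice_point R n z).
Proof. by move=> i; rewrite mxE intr_int. Qed.

Let measurable_all (D : set (discrete_rV R n)) : measurable D.
Proof. exact: Logic.I. Qed.

Let measurable_fun_all (D : set (discrete_rV R n)) h :
  @measurable_fun _ _ (discrete_rV R n) (\bar R) D h.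
Proof. by move=> mD Y mY; exact: measurable_all. Qed.

Lemma integral_lattice_point h z :
  \int[mu]_(x in [set lattice_point z]) h x = h (lattice_point z).
Proof.
rewrite (eq_integral (cst (h (lattice_point z)))); last first.
  by move=> x; rewrite inE => ->.
rewrite integral_cst // [mu _](_ : _ = 1) ?mule1 //.
rewrite /mu /= /lattice_enumerator setIidl; last first.
  by move=> _ ->; exact: lattice_point_int.
by rewrite /counting asboolT ?finite_set1 // fset_set1 finmap.cardfs1.
Qed.

Lemma lattice_sum_le_integral h (s : seq 'rV[int]_n) : (forall x, 0 <= h x) ->
  uniq s -> \sum_(z <- s) h (lattice_point z) <= \int[mu]_x h x.
Proof.
move=> h0 us; pose F z : set (discrete_rV R n) := [set lattice_point z].
have := @ge0_integral_bigsetU _ _ _ mu _ F h s (fun=> measurable_all _) us.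
rewrite (eq_bigr (fun z => h (lattice_point z))); last first.
  by move=> z _; exact: integral_lattice_point.
move=> <- //; first by apply: ge0_subset_integral.
by move=> z z' _ _ [x [-> /lattice_point_inj]].
Qed.

(** The measure lives on the countable lattice, so the integral is a series over an enumeration,
    whose partial sums are finite sums over distinct points. *)
Lemma integral_le_lattice_sum h B : (forall x, 0 <= h x) ->
  (forall s, uniq s -> \sum_(z <- s) h (lattice_point z) <= B) ->
  \int[mu]_x h x <= B.
Proof.
move=> h0 hB.
have L0 : mu (~` @integer_lattice R n) = 0.
  rewrite /mu /= /lattice_enumerator setICl.
  exact: (@measure0 _ _ _ (@counting (discrete_rV R n) R)).
rewrite (ge0_negligible_integral _ _ _ _ L0) // setDE setCK setTI.
(* Each lattice point is decoded by [pickle_inv] from a single [k], so the sets [F k] are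
   disjoint. *)
pose F k : set (discrete_rV R n) :=
  if @pickle_inv 'rV[int]_n k is Some z then [set lattice_point z] else set0.
have LF : @integer_lattice R n = \bigcup_k F k.
  apply/seteqP; split => x.
    move=> Lx; exists (pickle (\row_i Num.floor (x ord0 i))) => //.
    rewrite /F pickleK_inv; apply/rowP => i; rewrite !mxE.
    by have /intrP[m ->] := Lx i; rewrite intrKfloor.
  move=> [k _]; rewrite /F; case: pickle_inv => // z ->.
  exact: lattice_point_int.
rewrite LF ge0_integral_bigcup //; last first.
  move=> k k' _ _ [x [xk xk']]; move: xk xk'; rewrite /F.
  have := @pickle_invK 'rV[int]_n k; have := @pickle_invK 'rV[int]_n k'.
  case: pickle_inv => // z' /= <-; case: pickle_inv => // z /= <- ->.
  by move=> /lattice_point_inj ->.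
apply: lime_le; first by apply: is_cvg_nneseries => k _ _; exact: integral_ge0.
apply: nearW => m /=.
have := hB (pmap (@pickle_inv 'rV[int]_n) (iota 0 m)).
rewrite (pmap_uniq (@pickle_invK _)) ?iota_uniq // => /(_ isT).
rewrite big_pmap -[m in iota 0 m]subn0 -/(index_iota 0 m).
apply: le_trans; rewrite le_eqVlt; apply/orP; left; apply/eqP.
apply: eq_bigr => k _; rewrite /F.
by case: pickle_inv => [z|] /=; [rewrite integral_lattice_point | rewrite integral_set0].
Qed.

End lattice_integral.

(** * Layer-cake comparison of sums *)

Section layer_cake.
Context {R : realType}.

(* [e * levels N e a] is a Riemann sum of [\int_0^oo 1_(t < a) dt = a], and falls
   short of [a] by at most [e]. *)
Definition levels (N : nat) (e a : R) : nat := \sum_(k < N) (k.+1%:R * e < a)%R.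

Lemma levels_leq N e a : (levels N e a <= N)%N.
Proof.
rewrite -[leqRHS]card_ord -sum1_card; apply: leq_sum => i _.
by case: (_ < _).
Qed.

Lemma levels_le N (e a : R) : 0 < e -> 0 <= a -> e * (levels N e a)%:R <= a.
Proof.
move=> e0 a0; elim: N => [|N IH]; first by rewrite /levels big_ord0 mulr0.
rewrite /levels big_ord_recr /= -/(levels N e a).
have [lt|_] := ltP (N.+1%:R * e) a; last by rewrite addn0.
apply: le_trans (ltW lt); rewrite mulrC ler_pM2r // ler_nat addn1 ltnS.
exact: levels_leq.
Qed.

Lemma levels_ge N (e a : R) : 0 < e -> a <= N.+1%:R * e ->
  a <= e * (levels N e a).+1%:R.
Proof.
move=> e0; elim: N => [|N IH] aN.
  by rewrite /levels big_ord0 mulrC.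
rewrite /levels big_ord_recr /= -/(levels N e a).
have [lt|/IH] := ltP (N.+1%:R * e) a; last by rewrite addn0.
apply: le_trans aN _; rewrite mulrC ler_pM2l // ler_nat addn1 !ltnS.
rewrite -[leqLHS]card_ord -sum1_card; apply: leq_sum => i _.
have -> : i.+1%:R * e < a by apply: le_lt_trans lt; rewrite ler_pM2r // ler_nat ltnW // ltnS.
by [].
Qed.

Lemma sum_levels (T : eqType) (s : seq T) (h : T -> R) N e :
  (\sum_(z <- s) levels N e (h z) =
   \sum_(k < N) size [seq z <- s | (k.+1%:R * e < h z)%R])%N.
Proof.
rewrite exchange_big /=; apply: eq_bigr => k _.
rewrite size_filter -sum1_count [RHS]big_mkcond.
by apply: eq_bigr => z _; case: (_ < _).
Qed.

(* The layer-cake integrals of [h] and [g] are compared through Riemann sums of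
   step [e]; only the finitely many points where [g > e] contribute to the
   latter, so that all sums are finite. *)
Lemma sum_le_of_superlevel (T : eqType) (h g : T -> R) (C : nat) (M B : R) :
  (forall z, h z <= M) -> (forall z, 0 <= g z) ->
  (forall (t : R) (m : nat), 0 < t ->
    (forall v, uniq v -> {in v, forall z, t < g z} -> (size v <= m)%N) ->
    forall u, uniq u -> {in u, forall z, t < h z} -> (size u <= C * m)%N) ->
  (forall v, uniq v -> \sum_(z <- v) g z <= B) ->
  forall s, uniq s -> \sum_(z <- s) h z <= C%:R * B.
Proof.
move=> hM g0 hg gB s us; apply/ler_addgt0Pr => d d0.
(* Rounding loses at most [e] at each point of [s], hence at most [d] in total. *)
pose e := d / (size s).+1%:R.
have e0 : 0 < e by rewrite divr_gt0.
have es : e *+ size s <= d.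
  by rewrite /e -mulr_natr mulrAC ler_pdivrMr // ler_pM2l // ler_nat.
(* At most [B / e] points satisfy [g > e]; a longest list [v] of such points contains them all. *)
pose P m := `[< exists v : seq T, [/\ uniq v, {in v, forall z, e < g z} & size v = m] >].
have P0 : exists m, P m by exists 0%N; apply/asboolP; exists [::].
have PB m : P m -> (m <= Num.truncn (B / e))%N.
  move=> /asboolP[v [uv vg <-]]; rewrite truncn_ge_nat; last first.
    by rewrite divr_ge0 ?(ltW e0) //; have := gB [::] isT; rewrite big_nil.
  rewrite ler_pdivlMr // (le_trans _ (gB v uv)) //.
  rewrite -sum1_size natr_sum big_distrl /= !big_seq; apply: ler_sum => z /vg.
  by rewrite mul1r => /ltW.
case: (ex_maxnP P0 PB) => m /asboolP[v [uv vg vm]] vmax.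
have vall z : e < g z -> z \in v.
  move=> gz; apply/negPn/negP => zv.
  suff /vmax : P m.+1 by rewrite ltnn.
  apply/asboolP; exists (z :: v); split=> /=; rewrite ?zv ?vm // => x.
  by rewrite inE => /predU1P[->|/vg].
(* Enough thresholds to reach every value of [h], as [levels_ge] requires. *)
pose N := Num.truncn (M / e).
have hN z : h z <= N.+1%:R * e.
  by rewrite (le_trans (hM z)) // -ler_pdivrMr // ltW // truncnS_gt.
have levs : (\sum_(z <- s) levels N e (h z) <= C * \sum_(z <- v) levels N e (g z))%N.
  rewrite !sum_levels big_distrr /=; apply: leq_sum => k _.
  have ke : e <= k.+1%:R * e by rewrite ler_peMl ?(ltW e0) // ler1n.
  apply: (hg (k.+1%:R * e)); rewrite ?mulr_gt0 ?filter_uniq //.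
    move=> u uu ug; apply: uniq_leq_size => // z /ug gz.
    by rewrite mem_filter gz vall // (le_lt_trans ke).
  by move=> z; rewrite mem_filter => /andP[].
apply: (@le_trans _ _ (\sum_(z <- s) e * (levels N e (h z)).+1%:R)).
  by apply: ler_sum => z _; exact: levels_ge.
under eq_bigr do rewrite -natr1 mulrDr mulr1.
rewrite big_split /= -big_distrr /= -natr_sum addrC.
rewrite big_const_seq count_predT iter_addr addr0 addrC lerD //.
apply: (@le_trans _ _ (e * (C * \sum_(z <- v) levels N e (g z))%:R)).
  by rewrite ler_pM2l // ler_nat.
rewrite natrM mulrCA ler_wpM2l ?ler0n // (le_trans _ (gB v uv)) //.
rewrite natr_sum big_distrr /=; apply: ler_sum => z _; exact: levels_le.
Qed.

End layer_cake.

(** * Superlevel sets of log-concave functions *)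

Section log_concave.
Local Open Scope ereal_scope.
Context {R : realType} {n : nat}.
Implicit Types (f : 'rV[R]_n -> R).

Lemma log_concave_ge0 f x : log_concave f -> (0 <= f x)%R.
Proof. by move=> [u [_ _ uf]]; rewrite -lee_fin uf expeR_ge0. Qed.

(** On a segment, the convex [u] is at most its larger endpoint value. For [t >= 0] both endpoint
    values are finite, so the computation takes place in the reals. *)
Lemma convex_superlevel f (t : R) : log_concave f -> is_convex [set x | (t < f x)%R].
Proof.
move=> fl; have [u [uNy cu uf]] := fl.
move=> x y l l01 /= tx ty; rewrite -lte_fin uf.
have tE z : (t < f z)%R -> t%:E < expeR (- u z) by rewrite -lte_fin uf.
have [t0|t0] := ltP t 0%R; first by rewrite (lt_le_trans _ (expeR_ge0 _)) ?lte_fin.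
have ub z : (t < f z)%R -> u z \is a fin_num.
  move=> tz; rewrite fin_numE uNy /=; apply/eqP => uy.
  by move: (tE z tz); rewrite uy /= lte_fin ltNge t0.
wlog xy : x y l l01 tx ty / u x <= u y.
  move=> H; have [xy|/ltW yx] := leP (u x) (u y); first exact: H.
  have -> : (l *: x + (1 - l) *: y = (1 - l) *: y + (1 - (1 - l)) *: x)%R.
    by rewrite subKr addrC.
  apply: H => //.
  by move: l01 => /andP[? ?]; apply/andP; split; lra.
apply: lt_le_trans (tE y ty) _; rewrite lee_expeR leeN2.
apply: le_trans (cu x y l l01) _; move: xy (ub x tx) (ub y ty).
case: (u x) => // a; case: (u y) => // b; rewrite -!EFinM -EFinD !lee_fin => ab _ _.
by move: l01 => /andP[? ?]; nra.
Qed.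

End log_concave.

Local Open Scope ereal_scope.

(** * Asplund products and the inequality for bounded functions *)

Section asplund_lattice.
Context {R : realType} {n : nat}.
Context (f : 'rV[R]_n -> R) (fl : log_concave f).

Let f0 x : (0 <= f x)%R. Proof. exact: log_concave_ge0. Qed.

Let cube := @scaled_open_cube R n (3 / 4).

Lemma in_scaled_open_cube (r : R) (x : 'rV[R]_n) : (0 < r)%R ->
  scaled_open_cube r x <-> (forall i, `|x ord0 i| < r)%R.
Proof.
move=> r0; split.
  move=> [y /= yc <-] i; rewrite mxE normrM gtr0_norm // gtr_pMr //.
  by rewrite ltr_norml; exact: yc.
move=> xr; exists (r^-1 *: x)%R.
  move=> i; rewrite mxE -ltr_norml normrM gtr0_norm ?invr_gt0 //.
  by rewrite mulrC ltr_pdivrMr // mul1r.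
by rewrite scalerA mulfV ?scale1r // gt_eqF.
Qed.

Lemma asplund_ge0 (g : 'rV[R]_n -> R) x : (forall y, 0 <= g y)%R ->
  0 <= asplund f g x.
Proof.
move=> g0; apply: le_trans (ereal_sup_ubound (ex_intro2 _ _ 0%R Logic.I erefl)).
by rewrite lee_fin mulr_ge0.
Qed.

Let indic_ge0 y : (0 <= \1_cube y :> R)%R.
Proof. by rewrite indicE ler0n. Qed.

Lemma le_asplund_indic (x y : 'rV[R]_n) : (forall i, `|x ord0 i - y ord0 i| < 3 / 4)%R ->
  (f y)%:E <= asplund f (\1_cube) x.
Proof.
move=> xy; apply: ereal_sup_ubound; exists y => //.
rewrite indicE mem_set ?mulr1 //; apply/in_scaled_open_cube; first lra.
by move=> i; have := xy i; rewrite !mxE.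
Qed.

(** Rounding moves each coordinate by at most [1/2]. This makes the right-hand integral positive
    when [f] is unbounded. *)
Lemma exists_lattice_point_near (x : 'rV[R]_n) : exists z : 'rV[int]_n,
  forall i, (`|(lattice_point z : 'rV[R]_n) ord0 i - x ord0 i| < 3 / 4)%R.
Proof.
exists (\row_i Num.floor (x ord0 i + 1 / 2)%R) => i; rewrite !mxE ltr_norml.
have /andP[] := floor_itv (x ord0 i + 1 / 2)%R; rewrite intrD => ? ?.
by apply/andP; split; lra.
Qed.

Lemma asplund_difference_body (M t : R) x : (forall y, f y <= M)%R -> (0 < M)%R ->
  (M * t)%:E < asplund f (reflection f) x ->
  difference_body [set y | (t < f y)%R] x.
Proof.
move=> fM M0 /ereal_sup_gt[_ [y _ <-]]; rewrite lte_fin /reflection opprB => Mt.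
exists y, (y - x)%R; split => /=; last by rewrite subKr.
  by rewrite -(ltr_pM2l M0) (lt_le_trans Mt) // mulrC ler_wpM2r.
by rewrite -(ltr_pM2l M0) (lt_le_trans Mt) // ler_wpM2r.
Qed.

Lemma asplund_thicken (t : R) x : thicken (3 / 4) [set y | (t < f y)%R] x ->
  t%:E < asplund f (\1_cube) x.
Proof.
by move=> [y ty xy]; apply: lt_le_trans (le_asplund_indic xy); rewrite lte_fin.
Qed.

Lemma asplund_le (g : 'rV[R]_n -> R) (M N : R) x :
  (forall y, f y <= M)%R -> (forall y, 0 <= g y <= N)%R ->
  asplund f g x <= (M * N)%:E.
Proof.
move=> fM gN; apply: ge_ereal_sup => _ [y _ <-]; rewrite lee_fin.
by have /andP[? ?] := gN (x - y)%R; exact: ler_pM.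
Qed.

Lemma asplund_lattice_bounded (M : R) : (forall y, f y <= M)%R -> (0 < M)%R ->
  \int[@lattice_enumerator R n]_x asplund f (reflection f) x <=
  ('C(2 * n, n))%:R%:E * M%:E *
  \int[@lattice_enumerator R n]_x asplund f (\1_cube) x.
Proof.
move=> fM M0; set I := (X in _ <= _ * X).
have C0 : (0 < ('C(2 * n, n))%:R :> R)%R by rewrite ltr0n bin_gt0; lia.
have g0 x : 0 <= asplund f (\1_cube) x by exact: asplund_ge0.
have I0 : 0 <= I by exact: integral_ge0.
have h0 x : 0 <= asplund f (reflection f) x.
  by apply: asplund_ge0 => y; exact: f0.
have [Ioo|Ifin] := eqVneq I +oo.
  by rewrite Ioo gt0_muley ?leey // -EFinM lte_fin mulr_gt0.
have IE : I = (fine I)%:E by rewrite fineK // ge0_fin_numE // ltey.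
have gE x : asplund f (\1_cube) x = (fine (asplund f (\1_cube) x))%:E.
  rewrite fineK // ge0_fin_numE //; apply: le_lt_trans (ltry (M * 1)).
  apply: asplund_le => // y; rewrite indicE ler0n /=.
  by case: (_ \in _); rewrite ?lexx ?ler01.
have hE x : asplund f (reflection f) x = (fine (asplund f (reflection f) x))%:E.
  rewrite fineK // ge0_fin_numE //; apply: le_lt_trans (ltry (M * M)).
  by apply: asplund_le => // y; rewrite f0 fM.
apply: integral_le_lattice_sum => // s us.
rewrite IE; under eq_bigr do rewrite hE.
rewrite sumEFin -!EFinM lee_fin.
(* Division by [M] aligns the thresholds: [h > t] means that the product of [f] with its reflection
   exceeds [M t]. *)
pose h z := (fine (asplund f (reflection f) (lattice_point z)) / M)%R.
pose g z := fine (asplund f (\1_cube) (lattice_point z)).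
have -> : (\sum_(z <- s) fine (asplund f (reflection f) (lattice_point z)) =
    M * \sum_(z <- s) h z)%R.
  rewrite big_distrr /=; apply: eq_bigr => z _.
  by rewrite /h mulrCA mulfV ?mulr1 // gt_eqF.
rewrite mulrAC [leRHS]mulrC ler_pM2l //.
apply: (@sum_le_of_superlevel _ _ h g _ M) => //.
- move=> z; rewrite /h ler_pdivrMr // -lee_fin -hE.
  by apply: asplund_le => // y; rewrite f0 fM.
- by move=> z; rewrite fine_ge0.
- move=> t m t0 gm u uu uh.
  have Kt := convex_superlevel (t := t) fl.
  apply: (lattice_difference_body Kt).
    move=> v uv vK; apply: gm => // z /vK /asplund_thicken.
    by rewrite gE lte_fin.
  exists u; split=> // z /uh; rewrite /h ltr_pdivlMr // mulrC -lte_fin -hE.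
  exact: asplund_difference_body.
- move=> v uv; rewrite -lee_fin -IE -sumEFin; under eq_bigr do rewrite -gE.
  exact: lattice_sum_le_integral.
Qed.

End asplund_lattice.

(** * The inequality for an arbitrary value of the supremum *)

Theorem theorem1p2 (R : realType) (n : nat) (f : 'rV[R]_n -> R)
    (hf : integrable_log_concave f) :
  \int[@lattice_enumerator R n]_x asplund f (reflection f) x <=
  ('C(2 * n, n))%:R%:E * sup_norm f *
  \int[@lattice_enumerator R n]_x asplund f (\1_(@scaled_open_cube R n (3 / 4))) x.
Proof.
have [fl _ _] := hf.
have f0 x : (0 <= f x)%R by exact: log_concave_ge0.
have fN x : (f x)%:E <= sup_norm f by apply: ereal_sup_ubound; exists x.
have C0 : (0 < ('C(2 * n, n))%:R :> R)%R by rewrite ltr0n bin_gt0; lia.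
have g0 x : 0 <= asplund f (\1_(@scaled_open_cube R n (3 / 4))) x.
  by apply: asplund_ge0 => // y; rewrite indicE ler0n.
have h0 x : 0 <= asplund f (reflection f) x by apply: asplund_ge0 => // y; exact: f0.
case fE: (sup_norm f) fN => [M||] fN.
- have fM y : (f y <= M)%R by rewrite -lee_fin.
  have [M0|M0] := ltP 0%R M.
    by apply: asplund_lattice_bounded.
  (* Here [0 <= f <= M <= 0], so [f] vanishes and so does the left-hand side. *)
  apply: (@le_trans _ _ 0); last first.
    apply: mule_ge0; last exact: integral_ge0.
    by rewrite -EFinM lee_fin mulr_ge0 ?(ltW C0) // (le_trans (f0 0%R) (fM _)).
  apply: integral_le_lattice_sum => // s _; rewrite big1 // => z _.
  apply/eqP; rewrite eq_le h0 andbT -[leRHS](mule0 M%:E) -EFinM.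
  by apply: asplund_le => // y; rewrite f0 (le_trans (fM _) M0).
(* With an infinite supremum, the right-hand side is [+oo] once its integral is positive: a lattice
   point near a point where [f > 0] suffices. *)
- have [x fx] : exists x, (0 < f x)%R.
    have : 1%R%:E < sup_norm f by rewrite fE ltry.
    by move=> /ereal_sup_gt[_ [x _ <-]]; rewrite lte_fin => /(lt_trans ltr01); exists x.
  have [z zx] := exists_lattice_point_near x.
  have I0 : 0 < \int[@lattice_enumerator R n]_x
      asplund f (\1_(@scaled_open_cube R n (3 / 4))) x.
    have := lattice_sum_le_integral (s := [:: z]) g0 isT.
    rewrite big_seq1; apply: lt_le_trans.
    by apply: lt_le_trans (le_asplund_indic f zx); rewrite lte_fin.
  by rewrite gt0_muley ?lte_fin // gt0_mulye // leey.
- by have := fN 0%R.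
Qed.
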